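(* Let $n\ge3$ and $a,b\in\mathbb N$, and for $c,x,y\in\mathbb N$ set $$J_c(x,y)=J_n\begin{pmatrix}a&0&0\\ 0&b&0\\ x&y&c\end{pmatrix}.$$ Then for all $c,x,y\in\mathbb N$, with $L=a+b+c+x+y$, $$J_{c+2}(x,y)=\frac{(L+n)J_c(x,y)-(x+1)J_c(x+2,y)-(y+1)J_c(x,y+2)}{c+n-2},$$ and, if $a,b,x,y$ are even, $$J_0(x,y)=\frac{(n-2)!!\,(a+b+x+n-2)!!\,(a+b+y+n-2)!!}{(a+b+n-2)!!\,(a+x+n-2)!!\,(b+y+n-2)!!}.$$
   Context: For an integer $m\ge0$, $m!!$ denotes $(m-1)(m-3)\cdots$, the product of positive integers $\le m-1$ with the parity of $m-1$ (empty product $=1$). $O_n$ is the orthogonal group with Haar probability measure; for $a\in M_{p\times q}(\mathbb N)$, $p,q\le n$, $I_n(a)=\int_{O_n}\prod_{i,j}u_{ij}^{a_{ij}}\,du$, and $J_n(a)$ is defined by $I_n(a)=\frac{(n-1)!!\prod_{i,j}a_{ij}!!}{(\sum_{i,j}a_{ij}+n-1)!!}J_n(a)$. *)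

(* Defs.v *)
From HB Require Import structures.
From mathcomp Require Import all_boot all_order all_algebra.
From mathcomp Require Import all_classical all_reals all_analysis.

Set Implicit Arguments.
Unset Strict Implicit.
Unset Printing Implicit Defensive.

Import Order.TTheory GRing.Theory Num.Theory.
Import numFieldNormedType.Exports.

Local Open Scope classical_set_scope.
Local Open Scope ring_scope.

(* With this shifted convention 0!! = 1!! = 2!! = 1, 3!! = 2 and 4!! = 3.     *)
(* The truncation in [m.-1] is harmless: the range is empty for m = 0.        *)
Definition dfact (m : nat) : nat :=
  (\prod_(1 <= k < m | odd k == odd m.-1) k)%N.

Record orthogonal_group (R : realType) (n : nat) := Orthogonal {
  orthog_val :> 'M[R]_n;
  orthog_valP : orthog_val *m orthog_val^T == 1%:M }.

HB.instance Definition _ (R : realType) (n : nat) :=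
  [isSub for @orthog_val R n].
HB.instance Definition _ (R : realType) (n : nat) :=
  [Choice of orthogonal_group R n by <:].

Section OrthogonalGroup.
Variables (R : realType) (n : nat).
Implicit Types u v : orthogonal_group R n.

Lemma orthog_trK u : u^T *m u = 1%:M.
Proof. by apply: mulmx1C; apply/eqP; exact: orthog_valP. Qed.

Fact ortho1_subproof : (1%:M : 'M[R]_n) *m (1%:M)^T == 1%:M.
Proof. by rewrite trmx1 mulmx1. Qed.

Fact orthoV_subproof u : u^T *m (u^T)^T == 1%:M.
Proof. by rewrite trmxK orthog_trK. Qed.

Fact orthoM_subproof u v : (u *m v) *m (u *m v)^T == 1%:M.
Proof.
rewrite trmx_mul mulmxA -(mulmxA (orthog_val u)) (eqP (orthog_valP v)) mulmx1.
exact: orthog_valP.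
Qed.

Definition ortho1 := Orthogonal ortho1_subproof.
Definition orthoV u := Orthogonal (orthoV_subproof u).
Definition orthoM u v := Orthogonal (orthoM_subproof u v).

Fact orthoMA : associative orthoM.
Proof. by move=> u v w; apply: val_inj; rewrite /= mulmxA. Qed.
Fact ortho1M : left_id ortho1 orthoM.
Proof. by move=> u; apply: val_inj; rewrite /= mul1mx. Qed.
Fact orthoM1 : right_id ortho1 orthoM.
Proof. by move=> u; apply: val_inj; rewrite /= mulmx1. Qed.
Fact orthoVM : left_inverse ortho1 orthoV orthoM.
Proof. by move=> u; apply: val_inj; rewrite /= orthog_trK. Qed.
Fact orthoMV : right_inverse ortho1 orthoV orthoM.
Proof. by move=> u; apply: val_inj; apply/eqP; exact: orthog_valP. Qed.

HB.instance Definition _ :=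
  isGroup.Build (orthogonal_group R n) orthoMA ortho1M orthoM1 orthoVM orthoMV.

HB.instance Definition _ := isPointed.Build (orthogonal_group R n) ortho1.

(* Subspace topology from the space of matrices, and its Borel sets. *)
HB.instance Definition _ :=
  Topological.copy (orthogonal_group R n) (initial_topology (@orthog_val R n)).

HB.instance Definition _ := Measurable.copy (orthogonal_group R n)
  (g_sigma_algebraType (@open (orthogonal_group R n))).

End OrthogonalGroup.

(* O_n is a compact metrizable group, so regularity of the Borel measure [mu] *)
(* and its invariance under right translations are automatic.                 *)
Definition is_haar (R : realType) (n : nat)
    (mu : probability (orthogonal_group R n) R) : Prop :=
  forall (g : orthogonal_group R n) (A : set (orthogonal_group R n)),
    measurable A -> mu [set (g * u)%g | u in A] = mu A.

Section Moments.
Variables (R : realType) (n : nat) (mu : probability (orthogonal_group R n) R).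
Variables (p q : nat) (hp : (p <= n)%N) (hq : (q <= n)%N).

Definition I_moment (a : 'M[nat]_(p, q)) : R :=
  \int[mu]_u \prod_(i < p) \prod_(j < q)
    (u : 'M[R]_n) (widen_ord hp i) (widen_ord hq j) ^+ a i j.

Definition J_coef (a : 'M[nat]_(p, q)) : R :=
  (dfact (n - 1) * \prod_(i < p) \prod_(j < q) dfact (a i j))%N%:R
  / (dfact ((\sum_(i < p) \sum_(j < q) a i j) + n - 1))%:R.

Definition J_moment (a : 'M[nat]_(p, q)) : R := I_moment a / J_coef a.

Lemma dfact_gt0 m : (0 < dfact m)%N.
Proof.
rewrite /dfact big_seq_cond; apply: prodn_cond_gt0 => k.
by rewrite mem_index_iota => /andP[/andP[]].
Qed.

Lemma I_momentE a : I_moment a = J_coef a * J_moment a.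
Proof.
rewrite /J_moment mulrC divfK// /J_coef mulf_neq0 ?invr_eq0// pnatr_eq0 -lt0n.
  rewrite muln_gt0 dfact_gt0; apply: prodn_gt0 => i.
  by apply: prodn_gt0 => j; exact: dfact_gt0.
exact: dfact_gt0.
Qed.

End Moments.

Definition mx3 (a b x y c : nat) : 'M[nat]_3 :=
  \matrix_(i < 3, j < 3)
    nth 0%N (nth [::] [:: [:: a; 0; 0]; [:: 0; b; 0]; [:: x; y; c]]%N i) j.

(* Main.v *)
(* Rotating two rows (or two columns) infinitesimally preserves Haar measure, *)
(* so the integral of the corresponding derivative of any polynomial in the   *)
(* entries vanishes.  The recursion in c follows by integrating               *)
(* [\sum_j u_3j ^ 2 = 1], the columns [j > 3] being eliminated by rotating    *)
(* columns 3 and j.                                                           *)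
(* For the closed form, put u = column 1, v = column 2,                       *)
(* F = u_1^a v_2^b u_3^x v_3^y, M = E[F], P = E[u_2^2 F] and                   *)
(* T = E[u_1^a u_2 v_2^(b-1) u_3^(x+1) v_3^(y+1)].  The relations             *)
(* [|u|^2 = 1] and [u . v = 0] together with the rotations determine          *)
(* M(y+2) from M and T at level y, and then T at level y+2; by induction on y *)
(* one gets T = - (x+1)(y+1) M / ((a+b+x+y+n)(a+x+n-1)) alongside the product *)
(* formula for M.                                                             *)
Require Import Defs.
From mathcomp Require Import all_boot all_order all_algebra.
From mathcomp Require Import all_classical all_reals all_analysis.
From mathcomp Require Import measurable_realfun.
From mathcomp Require Import ring lra zify.

Import Order.TTheory GRing.Theory Num.Theory.
Import numFieldNormedType.Exports.

Local Open Scope ring_scope.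

Set Implicit Arguments.
Unset Strict Implicit.
Unset Printing Implicit Defensive.

(** * Polynomial functions on the orthogonal group *)

(** Two sources of linear relations between moments of the entries suffice. Left invariance under
    rotations in the plane of two rows makes the integral of the corresponding derivative vanish
    ([expect_tangent]); invariance under inversion ([expect_invg]) carries this over to columns
    ([expect_tangentV]). Orthonormality of rows and columns gives the rest.

    For the recursion, the unit norm of row 3 is inserted into the integral. Each of the [n - 3]
    columns beyond the first three contributes the moment with [c + 2] divided by [c + 1], so with
    column 3 the total coefficient is [(c + n - 2) / (c + 1)] ([row3_norm_rel]); normalizing by
    double factorials gives the stated form.

    For [c = 0] only two columns matter. The relations [norm_rel], [orth_rel], [rows23_rel],
    [columns_rel] and their mirror images form a system whose unknowns are the moment and a few
    auxiliary moments. It is solved along even exponents: first [x = y = 0], then [y = 0], then all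
    [y], carrying along one cross moment ([moment_cross_closed]). The product formula enters only
    through its ratios when an exponent grows by 2, so every induction step is an identity of
    rational functions. *)

Section Measurability.
Variables (R : realType) (n : nat).
Local Notation G := (orthogonal_group R n).

Definition entry (i j : 'I_n) (u : G) : R := orthog_val u i j.

Lemma continuous_mx (T : topologicalType) m p (f : T -> 'M[R]_(m, p)) :
  (forall i j, continuous (fun x => f x i j)) -> continuous f.
Proof.
move=> fc x A [P nP PA]; rewrite nbhs_filterE.
(* A neighbourhood of a matrix prescribes one neighbourhood per entry; finitely many are intersected
   along a list of indices. *)
have nbhsP (s : seq ('I_m * 'I_p)) :
    nbhs x [set y | forall ij, ij \in s -> P ij.1 ij.2 (f y ij.1 ij.2)]%classic.
  elim: s => [|[i j] s IHs]; first by apply: filterS filterT.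
  have fP : nbhs x [set y | P i j (f y i j)]%classic := fc i j x _ (nP i j).
  by apply: filterS (filterI fP IHs) => y [Pij Ps] ij; rewrite inE => /predU1P[->|/Ps].
by apply: filterS (nbhsP (enum predT)) => y Py; apply: PA => i j; apply: (Py (i, j));
  rewrite mem_enum.
Qed.

Lemma continuous_entry i j : continuous (entry i j).
Proof.
move=> u; apply: (@continuous_comp _ _ _ (@orthog_val R n) (fun M : 'M[R]_n => M i j)).
  exact: (@initial_continuous _ _ (@orthog_val R n)).
exact: coord_continuous.
Qed.

Lemma open_measurable_ortho (A : set G) : open A -> measurable A.
Proof. by move=> oA; apply: sub_sigma_algebra. Qed.

Lemma measurable_entry i j : measurable_fun setT (entry i j).
Proof.
apply: (measurability _ (RGenOpens.measurableE R)).
move=> _ [_ [a [b ->] <-]]; rewrite setTI; apply: open_measurable_ortho.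
have /continuousP := @continuous_entry i j; apply; exact: interval_open.
Qed.

Lemma measurable_ortho (F : G -> G) :
  (forall i j, continuous (fun u => entry i j (F u))) -> measurable_fun setT F.
Proof.
move=> Fc; have /continuousP Fo : continuous F.
  apply: (@continuous_comp_initial _ G _ (@orthog_val R n)).
  by apply: continuous_mx.
apply: (@measurability _ _ _ _ _ _ (@open G)) => //.
by move=> _ [A oA <-]; rewrite setTI; apply: open_measurable_ortho; exact: Fo.
Qed.

Lemma entryM i j (u v : G) : entry i j (u * v)%g = \sum_k entry i k u * entry k j v.
Proof. by rewrite /entry mxE. Qed.

Lemma entryV i j (u : G) : entry i j (u^-1)%g = entry j i u.
Proof. by rewrite /entry mxE. Qed.

Lemma measurable_mulg (g : G) : measurable_fun setT (fun u : G => (g * u)%g).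
Proof.
apply: measurable_ortho => i j; under eq_fun do rewrite entryM.
apply: continuous_big => [|k _ u]; first exact: add_continuous.
apply: (@continuous_comp _ _ _ (entry k j) ( *%R (entry i k g))).
  exact: continuous_entry.
exact: mulrl_continuous.
Qed.

Lemma measurable_invg : measurable_fun setT (fun u : G => (u^-1)%g).
Proof.
apply: measurable_ortho => i j; under eq_fun do rewrite entryV.
exact: continuous_entry.
Qed.

Lemma sum_entry_row i j (u : G) :
  \sum_k entry i k u * entry j k u = (i == j)%:R.
Proof.
have := congr1 (fun M : 'M[R]_n => M i j) (eqP (orthog_valP u)).
by rewrite !mxE => <-; apply: eq_bigr => k _; rewrite mxE.
Qed.

Lemma sum_entry_col i j (u : G) :
  \sum_k entry k i u * entry k j u = (i == j)%:R.
Proof.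
by rewrite -(sum_entry_row i j (u^-1)%g); apply: eq_bigr => k _; rewrite !entryV.
Qed.

Lemma entry_le1 i j (u : G) : `|entry i j u| <= 1.
Proof.
rewrite -(@ler_pXn2r _ 2) ?nnegrE// expr1n real_normK ?num_real//.
have <- : \sum_k entry i k u * entry i k u = 1 by rewrite sum_entry_row eqxx.
rewrite (bigD1 j)//= -expr2.
by rewrite lerDl sumr_ge0// => k _; rewrite -expr2 sqr_ge0.
Qed.

End Measurability.

(** * Expectations and the invariances of Haar measure *)

Section Expectation.
Variables (R : realType) (n : nat) (mu : probability (orthogonal_group R n) R).
Local Notation G := (orthogonal_group R n).
Implicit Types f g h : G -> R.

(** Boundedness is kept alongside measurability because it is stable under products and gives
    integrability for a probability measure. *)
Definition bmeas f := measurable_fun setT f /\ exists C, forall u, `|f u| <= C.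

Lemma bmeas_integrable f : bmeas f -> mu.-integrable setT (EFin \o f).
Proof.
move=> [mf [C fC]]; apply: measurable_bounded_integrable => //.
  by apply: le_lt_trans (probability_le1 mu _) _ => //; rewrite ltry.
exists C; split; first exact: num_real.
by move=> M CM u _; exact: le_trans (fC u) (ltW CM).
Qed.

Lemma bmeas_cst c : bmeas (fun=> c).
Proof. by split; [exact: measurable_cst|exists `|c|]. Qed.

Lemma bmeas_entry i j : bmeas (entry i j).
Proof. by split; [exact: measurable_entry|exists 1 => u; exact: entry_le1]. Qed.

Lemma bmeasD f g : bmeas f -> bmeas g -> bmeas (fun u => f u + g u).
Proof.
move=> [mf [C fC]] [mg [D gD]]; split; first exact: measurable_funD.
by exists (C + D) => u; apply: le_trans (ler_normD _ _) _; exact: lerD.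
Qed.

Lemma bmeasM f g : bmeas f -> bmeas g -> bmeas (fun u => f u * g u).
Proof.
move=> [mf [C fC]] [mg [D gD]]; split; first exact: measurable_funM.
by exists (C * D) => u; rewrite normrM; apply: ler_pM.
Qed.

Lemma bmeas_comp f (F : G -> G) : measurable_fun setT F -> bmeas f ->
  bmeas (fun u => f (F u)).
Proof.
move=> mF [mf [C fC]]; split; last by exists C.
exact: (measurableT_comp mf mF).
Qed.

Lemma bmeas_sum I (s : seq I) (f : I -> G -> R) : (forall i, bmeas (f i)) ->
  bmeas (fun u => \sum_(i <- s) f i u).
Proof.
move=> bf; elim: s => [|i s IHs].
  by under eq_fun do rewrite big_nil; exact: bmeas_cst.
by under eq_fun do rewrite big_cons; exact: bmeasD.
Qed.

Definition expect f : R := \int[mu]_u f u.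

Lemma eq_expect f g : f =1 g -> expect f = expect g.
Proof. by move=> /funext ->. Qed.

Lemma expect_cst c : expect (fun=> c) = c.
Proof. by rewrite /expect Rintegral_cst// [X in fine X](probability_setT mu) mulr1. Qed.

Lemma expectD f g : bmeas f -> bmeas g ->
  expect (fun u => f u + g u) = expect f + expect g.
Proof. by move=> bf bg; apply: RintegralD => //; exact: bmeas_integrable. Qed.

Lemma expectZ c f : bmeas f -> expect (fun u => c * f u) = c * expect f.
Proof. by move=> bf; apply: RintegralZl => //; exact: bmeas_integrable. Qed.

Lemma expect_sum I (s : seq I) (f : I -> G -> R) : (forall i, bmeas (f i)) ->
  expect (fun u => \sum_(i <- s) f i u) = \sum_(i <- s) expect (f i).
Proof.
move=> bf; elim: s => [|i s IHs].
  by under eq_expect do rewrite big_nil; rewrite expect_cst big_nil.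
under eq_expect do rewrite big_cons.
by rewrite expectD// ?IHs ?big_cons//; exact: bmeas_sum.
Qed.

Lemma expect_le f C : bmeas f -> (forall u, `|f u| <= C) -> `|expect f| <= C.
Proof.
move=> bf fC; apply: le_trans (le_normr_Rintegral _ (bmeas_integrable bf)) _ => //.
rewrite -[leRHS]expect_cst; apply: le_Rintegral => //.
  have [mf _] := bf; apply: (@bmeas_integrable (fun u => `|f u|)).
  split; last by exists C => u; rewrite normr_id.
  exact: measurableT_comp.
exact: bmeas_integrable (bmeas_cst C).
Qed.

Hypothesis hmu : is_haar mu.

(** [is_haar] speaks of images; a preimage under translation by [g] is an image under translation by
    its inverse. *)
Lemma haar_preimage (g : G) (A : set G) : measurable A ->
  mu ((fun u : G => (g * u)%g) @^-1` A)%classic = mu A.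
Proof.
move=> mA; rewrite -[RHS](@hmu (g^-1)%g)//; congr (mu _).
apply/seteqP; split => u /=; first by move=> Au; exists (g * u)%g; rewrite ?mulKg.
by move=> [v Av <-]; rewrite mulVKg.
Qed.

Lemma expect_mulg f (g : G) : bmeas f -> expect (fun u => f (g * u)%g) = expect f.
Proof.
move=> bf; rewrite /expect /Rintegral.
have mg := measurable_mulg g.
have mf : measurable_fun setT (EFin \o f) by apply/measurable_EFinP; case: bf.
have := integral_pushforward mg mf _ measurableT.
rewrite preimage_setT => <-; last exact: bmeas_integrable (bmeas_comp mg bf).
by congr fine; apply: eq_measure_integral => A mA _; exact: haar_preimage.
Qed.

(* The functions whose translates [v |-> f (u * v)] span a finite-dimensional *)
(* space.  Splitting [f (u * v)] makes Fubini a finite sum, which yields the  *)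
(* inversion invariance of [mu] on these functions without product measures.  *)
Definition representative f := bmeas f /\
  exists (I : finType) (g h : I -> G -> R),
    [/\ forall i, bmeas (g i), forall i, bmeas (h i)
      & forall u v, f (u * v)%g = \sum_i g i u * h i v].

Lemma representative_cst c : representative (fun=> c).
Proof.
split; first exact: bmeas_cst.
exists unit, (fun _ _ => c), (fun _ _ => 1); split => [_|_|u v]; try exact: bmeas_cst.
by rewrite big_const card_unit /= addr0 mulr1.
Qed.

Lemma representative_entry i j : representative (entry i j).
Proof.
split; first exact: bmeas_entry.
exists 'I_n, (entry i), (fun k => entry k j); split => *;
  [exact: bmeas_entry..|exact: entryM].
Qed.

Lemma representativeD f g :
  representative f -> representative g -> representative (fun u => f u + g u).
Proof.
move=> [bf [I [f1 [f2 [bf1 bf2 fE]]]]] [bg [J [g1 [g2 [bg1 bg2 gE]]]]].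
split; first exact: bmeasD.
exists (I + J)%type, (fun s => match s with inl i => f1 i | inr j => g1 j end),
  (fun s => match s with inl i => f2 i | inr j => g2 j end).
by split => [[]//|[]//|u v]; rewrite big_sumType fE gE.
Qed.

Lemma representativeM f g :
  representative f -> representative g -> representative (fun u => f u * g u).
Proof.
move=> [bf [I [f1 [f2 [bf1 bf2 fE]]]]] [bg [J [g1 [g2 [bg1 bg2 gE]]]]].
split; first exact: bmeasM.
exists (I * J)%type, (fun s u => f1 s.1 u * g1 s.2 u),
  (fun s u => f2 s.1 u * g2 s.2 u).
split => [ij|ij|u v]; [exact: bmeasM..|].
rewrite fE gE big_distrlr pair_bigA; apply: eq_bigr => ij _ /=; exact: mulrACA.
Qed.

Lemma representativeX f m : representative f -> representative (fun u => f u ^+ m).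
Proof.
move=> rf; elim: m => [|m IHm].
  by under eq_fun do rewrite expr0; exact: representative_cst.
by under eq_fun do rewrite exprS; exact: representativeM.
Qed.

(** Both sides equal the double integral of [f (u^-1 * v)]: by left invariance, integrating over [v]
    first gives the expectation of [f], and integrating over [u] first gives that of [f (u^-1)]. *)
Lemma expect_invg f : representative f -> expect (fun u => f (u^-1)%g) = expect f.
Proof.
move=> [bf [I [g [h [bg bh fE]]]]].
have bV f' : bmeas f' -> bmeas (fun u => f' (u^-1)%g).
  exact: bmeas_comp (@measurable_invg _ _).
have -> : expect f = \sum_i expect (fun u => g i (u^-1)%g) * expect (h i).
  rewrite -[LHS]expect_cst.
  under eq_expect => u.
    rewrite -(expect_mulg (u^-1)%g bf).
    under eq_expect do rewrite fE.
    rewrite expect_sum => [|i]; last by apply: bmeasM => //; exact: bmeas_cst.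
    under eq_bigr do rewrite expectZ// mulrC.
    over.
  rewrite expect_sum => [|i]; last by apply: bmeasM; [exact: bmeas_cst|exact: bV].
  by apply: eq_bigr => i _; rewrite expectZ; [rewrite mulrC|exact: bV].
rewrite -[LHS]expect_cst.
under eq_expect => v.
  rewrite -(expect_mulg (v^-1)%g (bV _ bf)).
  under eq_expect do rewrite invgM invgK fE.
  rewrite expect_sum => [|i]; last by apply: bmeasM; [exact: bV|exact: bmeas_cst].
  under eq_bigr => i _.
    under eq_expect do rewrite mulrC.
    rewrite expectZ; last exact: bV.
    rewrite mulrC.
    over.
  over.
rewrite expect_sum => [|i]; last by apply: bmeasM => //; exact: bmeas_cst.
by apply: eq_bigr => i _; rewrite expectZ.
Qed.

End Expectation.

(** * Infinitesimal rotations *)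

Section Infinitesimal.
Variables (R : realType) (n : nat) (mu : probability (orthogonal_group R n) R).
Local Notation G := (orthogonal_group R n).
Implicit Types f h : G -> R.

(* [df] is the derivative of [f] along the left translations by [r t] at t = 0, *)
(* with a remainder uniform in [u]. *)
Definition tangent (r : R -> G) f df :=
  [/\ representative f, representative df & exists C, forall t u, 0 <= t <= 1 ->
    `|f (r t * u)%g - f u - t * df u| <= C * t ^+ 2].

Lemma tangent_cst r c : tangent r (fun=> c) (fun=> 0).
Proof.
split; [exact: representative_cst..|exists 0 => t u _].
by rewrite mulr0 subrr subr0 normr0 mul0r.
Qed.

Lemma tangentM r f df h dh : tangent r f df -> tangent r h dh ->
  tangent r (fun u => f u * h u) (fun u => df u * h u + f u * dh u).
Proof.
move=> [rf rdf [C fC]] [rh rdh [D hD]]; split; first exact: representativeM.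
  by apply: representativeD; exact: representativeM.
have [[_ [Mf fM]] _] := rf; have [[_ [Mdf dfM]] _] := rdf.
have [[_ [Mh hM]] _] := rh; have [[_ [Mdh dhM]] _] := rdh.
exists (C * Mh + (Mf + Mdf) * D + Mdf * Mdh) => t u t01.
have /andP[t0 t1] := t01.
(* The remainder of a product splits into the two remainders times bounded factors ([t <= 1] bounds
   [f + t df]) and an explicit term of order [t ^+ 2]. *)
have -> : f (r t * u)%g * h (r t * u)%g - f u * h u - t * (df u * h u + f u * dh u)
  = (f (r t * u)%g - f u - t * df u) * h (r t * u)%g
    + (f u + t * df u) * (h (r t * u)%g - h u - t * dh u)
    + df u * dh u * t ^+ 2 by ring.
have t2 : `|t ^+ 2| = t ^+ 2 by rewrite ger0_norm// sqr_ge0.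
apply: le_trans (ler_normD _ _) _; rewrite [leRHS]mulrDl lerD//; last first.
  by rewrite 2!normrM t2 ler_wpM2r ?sqr_ge0// ler_pM.
apply: le_trans (ler_normD _ _) _; rewrite [leRHS]mulrDl lerD//.
  by rewrite normrM mulrAC ler_pM// fC.
rewrite normrM -mulrA ler_pM// ?hD//; apply: le_trans (ler_normD _ _) _.
by rewrite lerD// normrM -[leRHS]mul1r ler_pM// ger0_norm.
Qed.

Lemma tangentX r f df m : tangent r f df ->
  tangent r (fun u => f u ^+ m) (fun u => m%:R * f u ^+ m.-1 * df u).
Proof.
move=> fdf; elim: m => [|m IHm].
  under eq_fun do rewrite expr0.
  under [X in tangent _ _ X]eq_fun do rewrite !mul0r.
  exact: tangent_cst.
under eq_fun do rewrite exprS.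
have := tangentM fdf IHm; congr tangent; apply/funext => u /=.
by case: m {IHm} => [|m] /=; rewrite ?exprS; ring.
Qed.

Hypothesis hmu : is_haar mu.

(** Since [f (r t * u)] and [f u] have the same expectation, integrating the remainder bound gives
    [t * |E df| <= C * t ^+ 2] for all [t] in the unit interval. *)
Lemma expect_tangent r f df : tangent r f df -> expect mu df = 0.
Proof.
move=> [[bf _] [bdf _] [C fC]].
have bfr t : bmeas (fun u => f (r t * u)%g) by exact: bmeas_comp (measurable_mulg _) bf.
have bound t : 0 <= t <= 1 -> t * `|expect mu df| <= C * t ^+ 2.
  move=> t01; have /andP[t0 _] := t01.
  have bN h c : bmeas h -> bmeas (fun u => c * h u) by apply: bmeasM; exact: bmeas_cst.
  have -> : t * `|expect mu df|
      = `|expect mu (fun u => f (r t * u)%g + ((-1) * f u + (- t) * df u))|.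
    rewrite expectD ?expectD ?expectZ ?expect_mulg//;
      try by do ?[apply: bmeasD|apply: bN].
    by rewrite -{1}(ger0_norm t0) -normrM -normrN; congr `|_|; ring.
  apply: expect_le => [|u]; first by apply: bmeasD; rewrite //; apply: bmeasD; exact: bN.
  have -> : f (r t * u)%g + ((-1) * f u + (- t) * df u)
    = f (r t * u)%g - f u - t * df u by ring.
  exact: fC.
apply/eqP; rewrite -normr_le0 leNgt; apply/negP => e0.
set e := `|_| in bound e0 *.
have C0 : e <= C by have := bound 1; rewrite lexx ler01 mul1r expr1n mulr1 => ->.
have C1 : 0 < C by exact: lt_le_trans C0.
(* At [t = e / (2 * C)] the bound reads [t * e <= t * (e / 2)], which is absurd; [e <= C] keeps this
   [t] below 1. *)
have d0 : 0 < e / (2 * C) by rewrite divr_gt0// mulr_gt0.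
have d1 : e / (2 * C) <= 1 by rewrite ler_pdivrMr ?mulr_gt0// mul1r; lra.
have := bound (e / (2 * C)); rewrite ltW// d1 => /(_ isT).
have -> : C * (e / (2 * C)) ^+ 2 = e / (2 * C) * (e / 2) by field; rewrite gt_eqF.
by rewrite ler_pM2l//; lra.
Qed.

(** Inversion transposes the entries, so row rotations applied to [f] become column rotations after
    [u] is replaced by its inverse. *)
Lemma expect_tangentV r f df : tangent r f df ->
  expect mu (fun u => df (u^-1)%g) = 0.
Proof.
move=> fdf; have [_ rdf _] := fdf.
by rewrite (expect_invg hmu rdf); exact: expect_tangent fdf.
Qed.

Section Rotation.
Variables (i k : 'I_n) (ik : i != k).

Definition rot_mx (c s : R) : 'M[R]_n := \matrix_(p, q)
  (if p == i then c * (q == i)%:R + s * (q == k)%:R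
   else if p == k then c * (q == k)%:R - s * (q == i)%:R else (p == q)%:R).

Lemma rot_mxM c s m (A : 'M[R]_(n, m)) p q : (rot_mx c s *m A) p q =
  if p == i then c * A i q + s * A k q
  else if p == k then c * A k q - s * A i q else A p q.
Proof.
have sumd (l : 'I_n) : \sum_j (j == l)%:R * A j q = A l q.
  rewrite (bigD1 l)//= eqxx mul1r big1 ?addr0// => j /negPf ->; exact: mul0r.
rewrite mxE; under eq_bigr do rewrite mxE.
case: eqP => [_|_].
  under eq_bigr do rewrite mulrDl -!mulrA.
  by rewrite big_split -!mulr_sumr !sumd.
case: eqP => [_|_].
  under eq_bigr do rewrite mulrBl -!mulrA.
  by rewrite sumrB -!mulr_sumr !sumd.
by under eq_bigr do rewrite eq_sym; exact: sumd.
Qed.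

Lemma rot_mx_ortho c s : c ^+ 2 + s ^+ 2 = 1 ->
  rot_mx c s *m (rot_mx c s)^T == 1%:M.
Proof.
move=> cs; apply/eqP/matrixP => p q; rewrite rot_mxM !mxE.
have ki : k != i by rewrite eq_sym.
have e1 : c * c + s * s = 1 by rewrite -cs !expr2.
case: (eqVneq p i) => [?|pi]; last case: (eqVneq p k) => [?|pk];
  (case: (eqVneq q i) => [?|qi]; last case: (eqVneq q k) => [?|qk]); subst => //=;
  repeat match goal with
    H : is_true (?a != ?b) |- _ => rewrite ?(negPf H) ?[b == a]eq_sym ?(negPf H); clear H
  end; rewrite ?eqxx ?mulr0 ?addr0 ?mulr1 ?subr0 ?add0r ?sub0r ?mulrN ?opprK ?oppr0 //.
- by rewrite mulrC addNr.
- by rewrite [s * c]mulrC subrr.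
- by rewrite eq_sym.
Qed.

(* The rational parametrization of the circle, at unit speed at t = 0. *)
Lemma rot_circle (t : R) :
  ((4 - t ^+ 2) / (4 + t ^+ 2)) ^+ 2 + (4 * t / (4 + t ^+ 2)) ^+ 2 = 1.
Proof. by field; apply: lt0r_neq0; have := sqr_ge0 t; lra. Qed.

Definition rotation (t : R) : G := Orthogonal (rot_mx_ortho (rot_circle t)).

Lemma tangent_entry p q : tangent rotation (entry p q)
  (fun u => (p == i)%:R * entry k q u - (p == k)%:R * entry i q u).
Proof.
split; first exact: representative_entry.
  apply: representativeD; first by apply: representativeM;
    [exact: representative_cst|exact: representative_entry].
  under eq_fun do rewrite -mulNr.
  by apply: representativeM; [exact: representative_cst|exact: representative_entry].
exists 1 => t u /andP[t0 t1]; rewrite mul1r.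
have d0 : 0 < 4 + t ^+ 2 :> R by have := sqr_ge0 t; lra.
(* The remainder is [t ^+ 2] times [- (2 * x + t * y) / (4 + t ^+ 2)], whose numerator is at most 3
   in absolute value. Row [k] uses the same bound with [y] negated. *)
have key (x y : R) : `|x| <= 1 -> `|y| <= 1 ->
    `|(4 - t ^+ 2) / (4 + t ^+ 2) * x + 4 * t / (4 + t ^+ 2) * y - x - t * y| <= t ^+ 2.
  move=> x1 y1.
  have -> : (4 - t ^+ 2) / (4 + t ^+ 2) * x + 4 * t / (4 + t ^+ 2) * y - x - t * y
    = t ^+ 2 * (- (2 * x + t * y) / (4 + t ^+ 2)) by field; rewrite gt_eqF.
  rewrite normrM (ger0_norm (sqr_ge0 t)) -[leRHS]mulr1 ler_wpM2l ?sqr_ge0//.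
  rewrite normrM normrN normfV (gtr0_norm d0) ler_pdivrMr// mul1r.
  apply: le_trans (ler_normD _ _) _; rewrite !normrM (ger0_norm t0) ger0_norm//.
  have := sqr_ge0 t; have : t * `|y| <= 1 * 1 by rewrite ler_pM.
  lra.
have entryE : entry p q (rotation t * u)%g = if p == i
    then (4 - t ^+ 2) / (4 + t ^+ 2) * entry i q u + 4 * t / (4 + t ^+ 2) * entry k q u
    else if p == k
    then (4 - t ^+ 2) / (4 + t ^+ 2) * entry k q u - 4 * t / (4 + t ^+ 2) * entry i q u
    else entry p q u by exact: rot_mxM.
rewrite entryE; have [->|pi] := eqVneq p i.
  by rewrite (negPf ik) mul1r mul0r subr0; apply: key; exact: entry_le1.
have [->|pk] := eqVneq p k.
  rewrite mul0r mul1r sub0r -[X in _ + X - _ - _]mulrN.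
  by apply: key; rewrite ?normrN; exact: entry_le1.
by rewrite !mul0r !subrr mulr0 subr0 normr0 sqr_ge0.
Qed.

End Rotation.
End Infinitesimal.

(** * Linear relations between moments *)

Ltac representative_tac :=
  repeat first [exact: representative_entry | exact: representative_cst
    | apply: representativeX | apply: representativeM].

Section Relations.
Variables (R : realType) (n : nat) (mu : probability (orthogonal_group R n) R).
Hypothesis hmu : is_haar mu.
Local Notation G := (orthogonal_group R n).
Local Notation E := (expect mu).

Lemma expect_lin4 (k1 k2 k3 k4 : R) (f1 f2 f3 f4 : G -> R) :
  representative f1 -> representative f2 -> representative f3 -> representative f4 ->
  E (fun w => k1 * f1 w + k2 * f2 w + k3 * f3 w + k4 * f4 w) =
  k1 * E f1 + k2 * E f2 + k3 * E f3 + k4 * E f4.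
Proof.
move=> [b1 _] [b2 _] [b3 _] [b4 _].
have bZ k f : bmeas f -> bmeas (fun w => k * f w) by apply: bmeasM; exact: bmeas_cst.
by rewrite !expectD ?expectZ//; do ?[exact: bZ|apply: bmeasD].
Qed.

(** Turns a vanishing integral into a relation between moments. No relation below has more than four
    terms; spare slots receive coefficient 0 and the zero function. *)
Lemma expect_eq0_lin4 D k1 k2 k3 k4 f1 f2 f3 f4 :
  representative f1 -> representative f2 -> representative f3 -> representative f4 ->
  E D = 0 -> (forall w, D w = k1 * f1 w + k2 * f2 w + k3 * f3 w + k4 * f4 w) ->
  k1 * E f1 + k2 * E f2 + k3 * E f3 + k4 * E f4 = 0.
Proof.
by move=> ? ? ? ? D0 DE; rewrite -expect_lin4// -[RHS]D0; apply: eq_expect.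
Qed.

Section TwoColumns.
Variables (r1 r2 r3 : 'I_n) (c1 c2 : 'I_n).
Hypotheses (r12 : r1 != r2) (r13 : r1 != r3) (r23 : r2 != r3) (c12 : c1 != c2).
Let r21 : r2 != r1. Proof. by rewrite eq_sym. Qed.
Let r31 : r3 != r1. Proof. by rewrite eq_sym. Qed.
Let r32 : r3 != r2. Proof. by rewrite eq_sym. Qed.
Let c21 : c2 != c1. Proof. by rewrite eq_sym. Qed.
Local Notation u i := (entry i c1).
Local Notation v i := (entry i c2).

Definition mono a b x y (w : G) : R :=
  u r1 w ^+ a * v r2 w ^+ b * u r3 w ^+ x * v r3 w ^+ y.
Definition mom a b x y := E (mono a b x y).
(** [sqmom] arises from inserting [|u|^2 = 1] and [crmom] from inserting [u . v = 0]; [tmom] and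
    [tmom'] carry one entry outside the support of the monomial. *)
Definition sqmom i a b x y := E (fun w => u i w * u i w * mono a b x y w).
Definition crmom i a b x y := E (fun w => u i w * v i w * u r2 w * mono a b x y w).
Definition tmom a b x y := E (fun w => u r2 w * mono a b x y w).
Definition tmom' a b x y := E (fun w => v r1 w * mono a b x y w).

Lemma sqmom1 a b x y : sqmom r1 a b x y = mom a.+2 b x y.
Proof. by apply: eq_expect => w; rewrite /mono !exprS; ring. Qed.

Lemma sqmom3 a b x y : sqmom r3 a b x y = mom a b x.+2 y.
Proof. by apply: eq_expect => w; rewrite /mono !exprS; ring. Qed.

Lemma crmom2 a b x y : crmom r2 a b x y = sqmom r2 a b.+1 x y.
Proof. by apply: eq_expect => w; rewrite /mono !exprS; ring. Qed.

Lemma crmom3 a b x y : crmom r3 a b x y = tmom a b x.+1 y.+1.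
Proof. by apply: eq_expect => w; rewrite /mono !exprS; ring. Qed.

Lemma rep_mono a b x y : representative (mono a b x y).
Proof. rewrite /mono; representative_tac. Qed.

Lemma rep_sqmono i a b x y : representative (fun w => u i w * u i w * mono a b x y w).
Proof. rewrite /mono; representative_tac. Qed.

Lemma rep_crmono i a b x y :
  representative (fun w => u i w * v i w * u r2 w * mono a b x y w).
Proof. rewrite /mono; representative_tac. Qed.

Lemma rep_tmono a b x y : representative (fun w => u r2 w * mono a b x y w).
Proof. rewrite /mono; representative_tac. Qed.

Lemma rep_tmono' a b x y : representative (fun w => v r1 w * mono a b x y w).
Proof. rewrite /mono; representative_tac. Qed.

Let rE := (eqxx, negPf r12, negPf r21, negPf r13, negPf r31, negPf r23, negPf r32).

(** Rotate rows [r1] and [i] on [u_1^(a+1) u_i v_2^b u_3^x v_3^y]. *)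
Lemma sqmom_other i a b x y : i != r1 -> i != r2 -> i != r3 ->
  a.+1%:R * sqmom i a b x y = mom a.+2 b x y.
Proof.
move=> i1 i2 i3; have ri : r1 != i by rewrite eq_sym.
have tE p q := tangent_entry R ri p q.
have H := expect_tangent hmu (tangentM (tangentM (tangentM (tangentM
  (tangentX a.+1 (tE r1 c1)) (tE i c1))
  (tangentX b (tE r2 c2))) (tangentX x (tE r3 c1))) (tangentX y (tE r3 c2))).
have := expect_eq0_lin4 (k1 := a.+1%:R) (k2 := -1) (k3 := 0) (k4 := 0)
  (rep_sqmono i a b x y) (rep_mono a.+2 b x y)
  (representative_cst _ 0) (representative_cst _ 0) H.
rewrite -/(sqmom i a b x y) -/(mom a.+2 b x y) => /(_ _)/wrap[|H']; last by lra.
move=> w; rewrite /= !rE (negPf i1) (negPf ri).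
rewrite [r2 == i]eq_sym (negPf i2) [r3 == i]eq_sym (negPf i3).
by rewrite /mono !exprS /=; ring.
Qed.

(** Rotate rows [r1] and [r3] on [u_1^(a+1) u_3 v_2^b]; the absence of [v_3] means that no cross
    term appears. *)
Lemma mom_row3 a b : a.+1%:R * mom a b 2 0 = mom a.+2 b 0 0.
Proof.
have tE p q := tangent_entry R r13 p q.
have H := expect_tangent hmu (tangentM (tangentM
  (tangentX a.+1 (tE r1 c1)) (tE r3 c1)) (tangentX b (tE r2 c2))).
have := expect_eq0_lin4 (k1 := a.+1%:R) (k2 := -1) (k3 := 0) (k4 := 0)
  (rep_mono a b 2 0) (rep_mono a.+2 b 0 0)
  (representative_cst _ 0) (representative_cst _ 0) H.
rewrite -/(mom a b 2 0) -/(mom a.+2 b 0 0) => /(_ _)/wrap[|H']; last by lra.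
by move=> w; rewrite /= !rE /mono !exprS /=; ring.
Qed.

(* Below, an exponent [b.-1] or [y.-1] is junk at 0, where its coefficient [b%:R] *)
(* or [y%:R] vanishes. *)
Lemma crmom_other i a b x y : i != r1 -> i != r2 -> i != r3 ->
  sqmom r2 a b x y = sqmom i a b x y + b%:R * crmom i a b.-1 x y.
Proof.
move=> i1 i2 i3; have ri : r2 != i by rewrite eq_sym.
have tE p q := tangent_entry R ri p q.
have H := expect_tangent hmu (tangentM (tangentM (tangentM (tangentM (tangentM
  (tangentX b (tE r2 c2)) (tE r2 c1)) (tE i c1))
  (tangentX a (tE r1 c1))) (tangentX x (tE r3 c1))) (tangentX y (tE r3 c2))).
have := expect_eq0_lin4 (k1 := b%:R) (k2 := 1) (k3 := -1) (k4 := 0)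
  (rep_crmono i a b.-1 x y) (rep_sqmono i a b x y) (rep_sqmono r2 a b x y)
  (representative_cst _ 0) H.
rewrite -/(crmom i a b.-1 x y) -/(sqmom _ a b x y) -/(sqmom _ a b x y).
move=> /(_ _)/wrap[|H']; last by lra.
move=> w; rewrite /= !rE (negPf i2) (negPf ri).
rewrite [r1 == i]eq_sym (negPf i1) [r3 == i]eq_sym (negPf i3).
by rewrite /mono /=; ring.
Qed.

(** Rotate rows [r1] and [r2] on [u_1^(a+1) u_2 v_2^b u_3^x v_3^y]. *)
Lemma crmom_row1 a b x y :
  a.+1%:R * sqmom r2 a b x y = mom a.+2 b x y + b%:R * crmom r1 a b.-1 x y.
Proof.
have tE p q := tangent_entry R r12 p q.
have H := expect_tangent hmu (tangentM (tangentM (tangentM (tangentM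
  (tangentX a.+1 (tE r1 c1)) (tE r2 c1))
  (tangentX b (tE r2 c2))) (tangentX x (tE r3 c1))) (tangentX y (tE r3 c2))).
have := expect_eq0_lin4 (k1 := a.+1%:R) (k2 := -1) (k3 := - b%:R) (k4 := 0)
  (rep_sqmono r2 a b x y) (rep_mono a.+2 b x y) (rep_crmono r1 a b.-1 x y)
  (representative_cst _ 0) H.
rewrite -/(crmom r1 a b.-1 x y) -/(sqmom _ a b x y) -/(mom _ _ _ _).
move=> /(_ _)/wrap[|H']; last by lra.
by move=> w; rewrite /= !rE /mono !exprS /=; ring.
Qed.

(** Rotate rows [r2] and [r3] on [u_1^a u_2 v_2^b u_3^(x+1) v_3^y]. *)
Lemma rows23_rel a b x y :
  mom a b x.+2 y + b%:R * tmom a b.-1 x.+1 y.+1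
  = x.+1%:R * sqmom r2 a b x y + y%:R * tmom a b.+1 x.+1 y.-1.
Proof.
have tE p q := tangent_entry R r23 p q.
have H := expect_tangent hmu (tangentM (tangentM (tangentM (tangentM
  (tE r2 c1) (tangentX x.+1 (tE r3 c1)))
  (tangentX b (tE r2 c2))) (tangentX y (tE r3 c2))) (tangentX a (tE r1 c1))).
have := expect_eq0_lin4 (k1 := 1) (k2 := b%:R) (k3 := - x.+1%:R) (k4 := - y%:R)
  (rep_mono a b x.+2 y) (rep_tmono a b.-1 x.+1 y.+1) (rep_sqmono r2 a b x y)
  (rep_tmono a b.+1 x.+1 y.-1) H.
rewrite -/(mom _ _ _ _) -/(tmom _ _ _ _) -/(sqmom _ _ _ _ _) -/(tmom _ b.+1 _ _).
move=> /(_ _)/wrap[|H']; last by lra.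
by move=> w; rewrite /= !rE /mono !exprS /=; ring.
Qed.

(** Rotate the two columns on [u_1^a v_2^b u_3^(x+1) v_3^(y+1)]. This is the relation linking [tmom]
    to its mirror image [tmom']. *)
Lemma columns_rel a b x y :
  b%:R * tmom a b.-1 x.+1 y.+1 + y.+1%:R * mom a b x.+2 y
  = a%:R * tmom' a.-1 b x.+1 y.+1 + x.+1%:R * mom a b x y.+2.
Proof.
have tE p q := tangent_entry R c12 p q.
have H := expect_tangentV hmu (tangentM (tangentM (tangentM
  (tangentX a (tE c1 r1)) (tangentX b (tE c2 r2)))
  (tangentX x.+1 (tE c1 r3))) (tangentX y.+1 (tE c2 r3))).
have := expect_eq0_lin4 (k1 := - b%:R) (k2 := - y.+1%:R) (k3 := a%:R) (k4 := x.+1%:R)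
  (rep_tmono a b.-1 x.+1 y.+1) (rep_mono a b x.+2 y)
  (rep_tmono' a.-1 b x.+1 y.+1) (rep_mono a b x y.+2) H.
rewrite -/(mom _ _ _ _) -/(tmom _ _ _ _) -/(tmom' _ _ _ _) -/(mom _ _ _ y.+2).
move=> /(_ _)/wrap[|H']; last by lra.
by move=> w; rewrite /= !entryV !eqxx (negPf c12) (negPf c21) /mono !exprS /=; ring.
Qed.

Lemma sum_sqmom a b x y : \sum_i sqmom i a b x y = mom a b x y.
Proof.
rewrite -expect_sum => [|i]; last by have [] := rep_sqmono i a b x y.
by apply: eq_expect => w; rewrite -mulr_suml sum_entry_col eqxx mul1r.
Qed.

Lemma sum_crmom a b x y : \sum_i crmom i a b x y = 0.
Proof.
rewrite -expect_sum => [|i]; last by have [] := rep_crmono i a b x y.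
rewrite -[RHS](expect_cst mu); apply: eq_expect => w.
by rewrite -!mulr_suml sum_entry_col (negPf c12) !mul0r.
Qed.

Lemma sum_rows (F : 'I_n -> R) k :
  (forall i, i != r1 -> i != r2 -> i != r3 -> F i = k) ->
  \sum_i F i = F r1 + F r2 + F r3 + (n%:R - 3) * k.
Proof.
have D3 (F' : 'I_n -> R) : \sum_i F' i = F' r1 + F' r2 + F' r3
    + \sum_(i | (i != r1) && (i != r2) && (i != r3)) F' i.
  by rewrite (bigD1 r1)//= (bigD1 r2)//= (bigD1 r3) ?r31//= !addrA.
move=> Fk; rewrite D3; congr (_ + _).
rewrite (eq_bigr (fun=> 1 * k)) => [|i /andP[/andP[i1 i2] i3]]; last by rewrite mul1r Fk.
rewrite -mulr_suml; congr (_ * _).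
(* The same splitting, applied to the constant 1, counts the remaining indices: there are
   [n - 3]. *)
have := D3 (fun=> 1); rewrite sumr_const card_ord; lra.
Qed.

(** Insert [|u|^2 = 1]: row [r1] and the [n - 3] other rows together give [(a + 1) + (n - 3)] copies
    of [mom a.+2 b x y / a.+1%:R]. *)
Lemma norm_rel a b x y :
  mom a b x y = mom a b x.+2 y + sqmom r2 a b x y
    + (a%:R + n%:R - 2) * (mom a.+2 b x y / a.+1%:R).
Proof.
rewrite -[LHS]sum_sqmom (@sum_rows _ (mom a.+2 b x y / a.+1%:R)).
  rewrite sqmom1 sqmom3 -natr1.
  by field; rewrite nat1r pnatr_eq0.
by move=> i i1 i2 i3; rewrite -(sqmom_other _ _ _ _ i1 i2 i3) mulrC mulKf// pnatr_eq0.
Qed.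

(** Insert [u . v = 0] next to [u_2] and [v_2^(b-1)], and express rows [r1], [r2] and the others
    through [sqmom r2] and the moment with [a + 2]. *)
Lemma orth_rel a b x y :
  (a%:R + b%:R + n%:R - 2) * sqmom r2 a b x y + b%:R * tmom a b.-1 x.+1 y.+1
  = (a%:R + n%:R - 2) * (mom a.+2 b x y / a.+1%:R).
Proof.
set A := mom a.+2 b x y / a.+1%:R; set P := sqmom r2 a b x y.
have a0 : a.+1%:R != 0 :> R by rewrite pnatr_eq0.
have AE : mom a.+2 b x y = a.+1%:R * A by rewrite mulrC divfK.
(* The factor [b] makes the case [b = 0] trivial, where [b.-1] is not the intended exponent. *)
have := sum_crmom a b.-1 x y => /(congr1 ( *%R b%:R)).
rewrite mulr0 mulr_sumr (@sum_rows _ (P - A)) => [|i i1 i2 i3]; last first.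
  have sqA : sqmom i a b x y = A by apply: (mulfI a0); rewrite sqmom_other ?AE.
  by rewrite /P (crmom_other a b x y i1 i2 i3) sqA addrC addKr.
have := crmom_row1 a b x y; rewrite -/P AE crmom3 => e1.
have -> : b%:R * crmom r2 a b.-1 x y = b%:R * P.
  by rewrite /P; case: (b) => [|b'] /=; rewrite ?mul0r// crmom2.
rewrite -natr1 in e1 *; lra.
Qed.

End TwoColumns.
End Relations.

(** * Solving the relations *)

Lemma even_ind (Pr : nat -> Prop) : Pr 0%N ->
  (forall m, ~~ odd m -> Pr m -> Pr m.+2) -> forall m, ~~ odd m -> Pr m.
Proof.
move=> P0 PS m; rewrite -[m]odd_double_half => /[dup] /negbTE.
rewrite oddD odd_double addbF oddb => -> _; rewrite add0n.
by elim: m./2 => [//|k IHk]; rewrite doubleS; apply: PS; rewrite ?odd_double.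
Qed.

(** Casts of naturals are replaced by nonnegative unknowns, after which positivity of each
    denominator is linear arithmetic from [3 <= N]. *)
Ltac positive_denominators R :=
  repeat (apply/andP; split); apply: lt0r_neq0;
  repeat match goal with |- context [?m%:R] =>
    lazymatch m with 1%N => fail | _ =>
    have := ler0n R m; move: (m%:R) => ? ? end end; lra.

(* [M], [P], [T], [T'] stand for [mom], [sqmom r2], [tmom], [tmom'], [Q] for the *)
(* mirror image of [P] under the exchange of the two columns and of rows 1 and *)
(* 2, and [W] for the closed form of [M], given by its ratios. *)
Section ClosedForm.
Variables (R : realFieldType) (N : R) (M P Q T T' W : nat -> nat -> nat -> nat -> R).
Hypothesis N3 : 3 <= N.
Hypothesis M0 : M 0%N 0%N 0%N 0%N = 1.
Hypothesis Mx2 : forall a b, a.+1%:R * M a b 2%N 0%N = M a.+2 b 0%N 0%N.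
Hypothesis My2 : forall a b, b.+1%:R * M a b 0%N 2%N = M a b.+2 0%N 0%N.
Hypothesis normP : forall a b x y, M a b x y = M a b x.+2 y + P a b x y
  + (a%:R + N - 2) * (M a.+2 b x y / a.+1%:R).
Hypothesis normQ : forall a b x y, M a b x y = M a b x y.+2 + Q a b x y
  + (b%:R + N - 2) * (M a b.+2 x y / b.+1%:R).
Hypothesis orthP : forall a b x y,
  (a%:R + b%:R + N - 2) * P a b x y + b%:R * T a b.-1 x.+1 y.+1
  = (a%:R + N - 2) * (M a.+2 b x y / a.+1%:R).
Hypothesis orthQ : forall a b x y,
  (a%:R + b%:R + N - 2) * Q a b x y + a%:R * T' a.-1 b x.+1 y.+1
  = (b%:R + N - 2) * (M a b.+2 x y / b.+1%:R).
Hypothesis rowsP : forall a b x y,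
  M a b x.+2 y + b%:R * T a b.-1 x.+1 y.+1
  = x.+1%:R * P a b x y + y%:R * T a b.+1 x.+1 y.-1.
Hypothesis rowsQ : forall a b x y,
  M a b x y.+2 + a%:R * T' a.-1 b x.+1 y.+1
  = y.+1%:R * Q a b x y + x%:R * T' a.+1 b x.-1 y.+1.
Hypothesis cols : forall a b x y,
  b%:R * T a b.-1 x.+1 y.+1 + y.+1%:R * M a b x.+2 y
  = a%:R * T' a.-1 b x.+1 y.+1 + x.+1%:R * M a b x y.+2.
Hypothesis W0 : W 0%N 0%N 0%N 0%N = 1.
Hypothesis Wa : forall a b x y, W a.+2 b x y = (a%:R + 1)
  * (a%:R + b%:R + x%:R + N - 1) * (a%:R + b%:R + y%:R + N - 1)
  / ((a%:R + b%:R + x%:R + y%:R + N) * (a%:R + b%:R + N - 1) * (a%:R + x%:R + N - 1))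
  * W a b x y.
Hypothesis Wb : forall a b x y, W a b.+2 x y = (b%:R + 1)
  * (a%:R + b%:R + x%:R + N - 1) * (a%:R + b%:R + y%:R + N - 1)
  / ((a%:R + b%:R + x%:R + y%:R + N) * (a%:R + b%:R + N - 1) * (b%:R + y%:R + N - 1))
  * W a b x y.
Hypothesis Wx : forall a b x y, W a b x.+2 y =
  (x%:R + 1) * (a%:R + b%:R + x%:R + N - 1)
  / ((a%:R + b%:R + x%:R + y%:R + N) * (a%:R + x%:R + N - 1)) * W a b x y.
Hypothesis Wy : forall a b x y, W a b x y.+2 =
  (y%:R + 1) * (a%:R + b%:R + y%:R + N - 1)
  / ((a%:R + b%:R + x%:R + y%:R + N) * (b%:R + y%:R + N - 1)) * W a b x y.

Let nat_ge0 m : 0 <= m%:R :> R. Proof. exact: ler0n. Qed.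

(** The system at [x = y = 0]: eliminating [t] gives [(a + b + N - 1) P' = (a + N - 1) A] and
    [m = P' + (a + N - 1) A]. Stated for plain scalars so that it serves both a relation and its
    mirror image. *)
Lemma corner_step (a b p m m2 A P' t : R) : 0 <= a -> 0 <= b ->
  m2 = A -> m = m2 + P' + (a + N - 2) * A ->
  (a + b + N - 2) * P' + t = (a + N - 2) * A -> m2 + t = P' ->
  A = (a + b + N - 1) / ((a + b + N) * (a + N - 1)) * m.
Proof.
move=> a0 b0 m2A mE o r; have ? := N3.
have n1 : a + b + N != 0 by apply: lt0r_neq0; lra.
have n2 : a + N - 1 != 0 by apply: lt0r_neq0; lra.
have PE : (a + b + N - 1) * P' = (a + N - 1) * A by lra.
have mP : m = P' + (a + N - 1) * A by lra.
have : (a + b + N - 1) * m = (a + b + N) * (a + N - 1) * A.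
  by rewrite mP mulrDr PE; ring.
by move=> e; rewrite mulrAC e mulrC mulKf// mulf_neq0.
Qed.

Lemma moment_corner a b : ~~ odd a -> ~~ odd b -> M a b 0%N 0%N = W a b 0%N 0%N.
Proof.
move=> ea eb; elim/even_ind: a / ea; first elim/even_ind: b / eb.
- by rewrite M0 W0.
- move=> b _ IHb.
  have b0 : b.+1%:R != 0 :> R by rewrite pnatr_eq0.
  (* The mirrored system at [a = 0], where the cross moment has coefficient 0. *)
  have := @corner_step b%:R 0 0 (M 0%N b 0%N 0%N) (M 0%N b 0%N 2%N)
    (M 0%N b.+2 0%N 0%N / b.+1%:R) (Q 0%N b 0%N 0%N) 0 (nat_ge0 _) (lexx _).
  rewrite -My2 mulrAC divff// mul1r => /(_ erefl) H.
  have H1 := normQ 0%N b 0%N 0%N;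
  have H2 := orthQ 0%N b 0%N 0%N; have H3 := rowsQ 0%N b 0%N 0%N.
  rewrite -My2 [_ * M _ _ _ _ / _]mulrAC divff// mul1r in H1 H2.
  rewrite H ?Wb -?IHb; [|lra..].
  rewrite -natr1; field.
  have ? := N3; positive_denominators R.
- move=> a _ IHa.
  have a0 : a.+1%:R != 0 :> R by rewrite pnatr_eq0.
  have := @corner_step a%:R b%:R 0 (M a b 0%N 0%N) (M a b 2%N 0%N)
    (M a.+2 b 0%N 0%N / a.+1%:R) (P a b 0%N 0%N) (b%:R * T a b.-1 1%N 1%N) (nat_ge0 _) (nat_ge0 _).
  rewrite -Mx2 mulrAC divff// mul1r => /(_ erefl) H.
  have H1 := normP a b 0%N 0%N;
  have H2 := orthP a b 0%N 0%N; have H3 := rowsP a b 0%N 0%N.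
  rewrite -Mx2 [_ * M _ _ _ _ / _]mulrAC divff// mul1r in H1 H2.
  rewrite H ?Wa -?IHa; [|lra..].
  rewrite -natr1; field.
  have ? := N3; positive_denominators R.
Qed.

(** At [y = 0] the three relations combine to [M = (a + b + x + N) P], and [normP] then yields the
    moment with [x + 2]. It involves the moment with [a + 2], so the induction hypothesis must range
    over all even [a] and [b]. *)
Lemma moment_row3_col1 x : ~~ odd x ->
  forall a b, ~~ odd a -> ~~ odd b -> M a b x 0%N = W a b x 0%N.
Proof.
move=> ex; elim/even_ind: x / ex => [|x _ IHx] a b ea eb; first exact: moment_corner.
have H1 := normP a b x 0%N; have H2 := orthP a b x 0%N; have H3 := rowsP a b x 0%N.
set A := _ / _ in H1 H2; rewrite -natr1 in H3.
have HP : (a%:R + b%:R + x%:R + N) * P a b x 0%N = M a b x 0%N by lra.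
have n0 : a%:R + b%:R + x%:R + N != 0 by have ? := N3; positive_denominators R.
have -> : M a b x.+2 0%N = M a b x 0%N - P a b x 0%N
  - (a%:R + N - 2) * A by lra.
have -> : P a b x 0%N = M a b x 0%N / (a%:R + b%:R + x%:R + N).
  by rewrite -HP mulrC mulKf.
rewrite /A !IHx //= ?negbK// Wa Wx -natr1; field; have ? := N3; positive_denominators R.
Qed.

(** The three relations give [(a + b + x + N) P = M - y T], with [T] the cross moment two levels
    lower in [y]; [rowsP] then yields the next cross moment. The factors [b] and [y] absorb the
    truncated exponents at 0. *)
Lemma cross_step a b x y :
  M a b x y = W a b x y -> M a b x.+2 y = W a b x.+2 y ->
  y%:R * T a b.+1 x.+1 y.-1 = - (y%:R * (x%:R + 1) * (b%:R + 1)
    * (a%:R + b%:R + x%:R + N - 1)) / ((a%:R + b%:R + N - 1)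
    * (a%:R + b%:R + x%:R + y%:R + N) * (a%:R + x%:R + N - 1)) * W a b x y ->
  b%:R * T a b.-1 x.+1 y.+1 = - (b%:R * (x%:R + 1) * (y%:R + 1))
    / ((a%:R + b%:R + x%:R + y%:R + N) * (a%:R + x%:R + N - 1)) * W a b x y.
Proof.
move=> HM HMx Ht.
have H1 := normP a b x y; have H2 := orthP a b x y; have H3 := rowsP a b x y.
set A := _ / _ in H1 H2; rewrite -natr1 in H3.
have HP : (a%:R + b%:R + x%:R + N) * P a b x y
    = M a b x y - y%:R * T a b.+1 x.+1 y.-1 by lra.
have n0 : a%:R + b%:R + x%:R + N != 0 by have ? := N3; positive_denominators R.
have PE : P a b x y = (M a b x y - y%:R * T a b.+1 x.+1 y.-1)
    / (a%:R + b%:R + x%:R + N) by rewrite -HP mulrC mulKf.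
have -> : b%:R * T a b.-1 x.+1 y.+1 = (x%:R + 1) * P a b x y
    + y%:R * T a b.+1 x.+1 y.-1 - M a b x.+2 y by lra.
rewrite PE Ht HM HMx Wx; field; have ? := N3; positive_denominators R.
Qed.

Lemma moment_cross_closed y : ~~ odd y ->
  forall a b x, ~~ odd a -> ~~ odd b -> ~~ odd x -> M a b x y = W a b x y /\
  b%:R * T a b.-1 x.+1 y.+1 = - (b%:R * (x%:R + 1) * (y%:R + 1))
    / ((a%:R + b%:R + x%:R + y%:R + N) * (a%:R + x%:R + N - 1)) * W a b x y.
Proof.
move=> ey; elim/even_ind: y / ey => [|y _ IHy] a b x ea eb ex.
  split; first exact: moment_row3_col1.
  by apply: cross_step; rewrite ?moment_row3_col1//= ?negbK// !mul0r oppr0 !mul0r.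
have My2_closed a' b' x' : ~~ odd a' -> ~~ odd b' -> ~~ odd x' ->
    M a' b' x' y.+2 = W a' b' x' y.+2.
  move=> ea' eb' ex'; have [HM HT] := IHy a' b' x' ea' eb' ex'.
  have [HMx _] : _ /\ _ := IHy a' b' x'.+2 ea' eb' (etrans (congr1 _ (negbK _)) ex').
  have [HMb _] : _ /\ _ := IHy a' b'.+2 x' ea' (etrans (congr1 _ (negbK _)) eb') ex'.
  have H1 := normQ a' b' x' y; have H2 := orthQ a' b' x' y; have H3 := cols a' b' x' y.
  set B := _ / _ in H1 H2.
  have n0 : a'%:R + b'%:R + x'%:R + N - 1 != 0 by have ? := N3; positive_denominators R.
  apply: (mulfI n0).
  (* [normQ] times [a + b + N - 2] lets [orthQ] remove [Q]; [cols] then trades the unknown [T'] for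
     the known [T], leaving only moments of level [y] on the right. *)
  have -> : (a'%:R + b'%:R + x'%:R + N - 1) * M a' b' x' y.+2
    = (a'%:R + b'%:R + N - 2) * (M a' b' x' y - (b'%:R + N - 2) * B)
      - (b'%:R + N - 2) * B
      + b'%:R * T a' b'.-1 x'.+1 y.+1 + y.+1%:R * M a' b' x'.+2 y.
    have H4 := congr1 ( *%R (a'%:R + b'%:R + N - 2)) H1.
    by rewrite -[x'.+1%:R]natr1 in H3; lra.
  rewrite /B HT HMx HMb HM Wx Wb Wy -!natr1; field;
  have ? := N3; positive_denominators R.
split; first exact: My2_closed.
apply: cross_step; rewrite ?My2_closed//= ?negbK//.
(* The lower cross moment required at level [y + 2] is the one known at level [y] with [b + 2] in
   place of [b]. *)
have [_ /= HT] := IHy a b.+2 x ea (etrans (congr1 _ (negbK _)) eb) ex.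
have b2 : b.+2%:R != 0 :> R by rewrite pnatr_eq0.
apply: (mulfI b2); rewrite mulrCA HT Wb Wy -!natr1; field;
  have ? := N3; positive_denominators R.
Qed.

End ClosedForm.

(** * The moments of the theorem *)

Section LastEntry.
Variables (R : realType) (n : nat) (mu : probability (orthogonal_group R n) R).
Hypothesis hmu : is_haar mu.
Variables (r1 r2 r3 c1 c2 c3 : 'I_n).
Hypotheses (r13 : r1 != r3) (r23 : r2 != r3).
Hypotheses (c12 : c1 != c2) (c13 : c1 != c3) (c23 : c2 != c3).
Local Notation G := (orthogonal_group R n).
Local Notation E := (expect mu).

Definition mono3 a b x y c (w : G) : R :=
  mono r1 r2 r3 c1 c2 a b x y w * entry r3 c3 w ^+ c.

Lemma rep_mono3 a b x y c : representative (mono3 a b x y c).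
Proof. rewrite /mono3 /mono; representative_tac. Qed.

Lemma rep_sqmono3 j a b x y c :
  representative (fun w => entry r3 j w * entry r3 j w * mono3 a b x y c w).
Proof. rewrite /mono3 /mono; representative_tac. Qed.

(** Rotate columns [c3] and [j] on the monomial of exponent [c + 1] at [(r3, c3)] times the entry
    [(r3, j)]. *)
Lemma sqmono3_other j a b x y c : j != c1 -> j != c2 -> j != c3 ->
  c.+1%:R * E (fun w => entry r3 j w * entry r3 j w * mono3 a b x y c w)
  = E (mono3 a b x y c.+2).
Proof.
move=> j1 j2 j3; have cj : c3 != j by rewrite eq_sym.
have tE p q := tangent_entry R cj p q.
have H := expect_tangentV hmu (tangentM (tangentM (tangentM (tangentM (tangentM
  (tangentX a (tE c1 r1)) (tangentX b (tE c2 r2)))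
  (tangentX x (tE c1 r3))) (tangentX y (tE c2 r3)))
  (tangentX c.+1 (tE c3 r3))) (tE j r3)).
have := expect_eq0_lin4 (k1 := c.+1%:R) (k2 := -1) (k3 := 0) (k4 := 0)
  (rep_sqmono3 j a b x y c) (rep_mono3 a b x y c.+2)
  (representative_cst _ 0) (representative_cst _ 0) H.
move=> /(_ _)/wrap[|H']; last by lra.
move=> w; rewrite /= !entryV !eqxx (negPf c13) (negPf c23) (negPf cj) (negPf j3).
rewrite [c1 == j]eq_sym (negPf j1) [c2 == j]eq_sym (negPf j2).
by rewrite /mono3 /mono !exprS /=; ring.
Qed.

Lemma row3_norm_rel a b x y c : (2 <= n)%N ->
  E (mono3 a b x y c) = E (mono3 a b x.+2 y c) + E (mono3 a b x y.+2 c)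
    + (c + n - 2)%:R / c.+1%:R * E (mono3 a b x y c.+2).
Proof.
move=> n2; have c0 : c.+1%:R != 0 :> R by rewrite pnatr_eq0.
have -> : E (mono3 a b x y c)
    = \sum_j E (fun w => entry r3 j w * entry r3 j w * mono3 a b x y c w).
  rewrite -expect_sum => [|j]; last by have [] := rep_sqmono3 j a b x y c.
  by apply: eq_expect => w; rewrite -mulr_suml sum_entry_row eqxx mul1r.
rewrite (sum_rows c12 c13 c23 (k := E (mono3 a b x y c.+2) / c.+1%:R)); last first.
  move=> j j1 j2 j3.
  by rewrite -(sqmono3_other a b x y c j1 j2 j3) mulrC mulKf.
have -> : E (mono3 a b x.+2 y c)
    = E (fun w => entry r3 c1 w * entry r3 c1 w * mono3 a b x y c w).
  by apply: eq_expect => w; rewrite /mono3 /mono !exprS; ring.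
have -> : E (mono3 a b x y.+2 c)
    = E (fun w => entry r3 c2 w * entry r3 c2 w * mono3 a b x y c w).
  by apply: eq_expect => w; rewrite /mono3 /mono !exprS; ring.
have -> : E (mono3 a b x y c.+2)
    = E (fun w => entry r3 c3 w * entry r3 c3 w * mono3 a b x y c w).
  by apply: eq_expect => w; rewrite /mono3 /mono !exprS; ring.
rewrite natrB ?natrD; last by lia.
by rewrite -natr1 in c0 *; field.
Qed.

End LastEntry.

(** * Double factorials and the ratios of the closed form *)

Lemma dfactS m : dfact m.+2 = (m.+1 * dfact m)%N.
Proof.
rewrite /dfact; case: m => [|m]; first by rewrite !unlock.
rewrite [LHS]big_mkcond big_nat_recr//= big_nat_recr//= eqxx.
have -> : (odd m.+1 == ~~ odd m.+1) = false by case: (odd m.+1).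
rewrite muln1 mulnC; congr (_ * _)%N; rewrite [RHS]big_mkcond.
by apply: eq_bigr => k _; rewrite /= negbK.
Qed.

Section ClosedFormWeight.
Variables (R : realFieldType) (n : nat).
Hypothesis n3 : (3 <= n)%N.
Local Notation N := (n%:R : R).

Definition dfact1 s : R := (dfact (s + n - 1))%:R.
Definition dfact2 s : R := (dfact (s + n - 2))%:R.

Lemma dfact1S s : dfact1 s.+2 = (s%:R + N) * dfact1 s.
Proof.
rewrite /dfact1 (_ : (s.+2 + n - 1 = (s + n - 1).+2)%N); last by lia.
rewrite dfactS natrM (_ : ((s + n - 1).+1 = s + n)%N) ?natrD//; lia.
Qed.

Lemma dfact2S s : dfact2 s.+2 = (s%:R + N - 1) * dfact2 s.
Proof.
rewrite /dfact2 (_ : (s.+2 + n - 2 = (s + n - 2).+2)%N); last by lia.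
rewrite dfactS natrM (_ : ((s + n - 2).+1 = s + n - 1)%N); last by lia.
by rewrite natrB ?natrD//; lia.
Qed.

Lemma dfact1_neq0 s : dfact1 s != 0.
Proof. by rewrite pnatr_eq0 -lt0n dfact_gt0. Qed.

Lemma dfact2_neq0 s : dfact2 s != 0.
Proof. by rewrite pnatr_eq0 -lt0n dfact_gt0. Qed.

Definition closed_J a b x y : R :=
  dfact2 0 * dfact2 (a + b + x) * dfact2 (a + b + y)
  / (dfact2 (a + b) * dfact2 (a + x) * dfact2 (b + y)).

Definition closed_I a b x y : R :=
  dfact1 0 * ((dfact a)%:R * (dfact b)%:R * (dfact x)%:R * (dfact y)%:R)
  / dfact1 (a + b + x + y) * closed_J a b x y.

Lemma closed_I0 : closed_I 0 0 0 0 = 1.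
Proof.
have d0 : dfact 0 = 1%N by rewrite /dfact unlock.
rewrite /closed_I /closed_J !add0n d0.
by field; rewrite dfact1_neq0 dfact2_neq0.
Qed.

Lemma closed_Ia a b x y : closed_I a.+2 b x y = (a%:R + 1)
  * (a%:R + b%:R + x%:R + N - 1) * (a%:R + b%:R + y%:R + N - 1)
  / ((a%:R + b%:R + x%:R + y%:R + N) * (a%:R + b%:R + N - 1) * (a%:R + x%:R + N - 1))
  * closed_I a b x y.
Proof.
have N3 : 3 <= N by rewrite (ler_nat _ 3).
rewrite /closed_I /closed_J !addSn dfact1S !dfact2S dfactS natrM -natr1 !natrD.
field; rewrite ?dfact1_neq0 ?dfact2_neq0 ?andbT /=;
  (* [N] is itself a cast here; it is abstracted together with its bound, since the tactic would
     retain only its nonnegativity. *)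
  move: N N3 => N' N3; positive_denominators R.
Qed.

Lemma closed_Ib a b x y : closed_I a b.+2 x y = (b%:R + 1)
  * (a%:R + b%:R + x%:R + N - 1) * (a%:R + b%:R + y%:R + N - 1)
  / ((a%:R + b%:R + x%:R + y%:R + N) * (a%:R + b%:R + N - 1) * (b%:R + y%:R + N - 1))
  * closed_I a b x y.
Proof.
have N3 : 3 <= N by rewrite (ler_nat _ 3).
rewrite /closed_I /closed_J !(addSn, addnS) dfact1S !dfact2S dfactS natrM -natr1 !natrD.
field; rewrite ?dfact1_neq0 ?dfact2_neq0 ?andbT /=;
  move: N N3 => N' N3; positive_denominators R.
Qed.

Lemma closed_Ix a b x y : closed_I a b x.+2 y =
  (x%:R + 1) * (a%:R + b%:R + x%:R + N - 1)
  / ((a%:R + b%:R + x%:R + y%:R + N) * (a%:R + x%:R + N - 1)) * closed_I a b x y.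
Proof.
have N3 : 3 <= N by rewrite (ler_nat _ 3).
rewrite /closed_I /closed_J !(addSn, addnS) dfact1S !dfact2S dfactS natrM -natr1 !natrD.
field; rewrite ?dfact1_neq0 ?dfact2_neq0 ?andbT /=;
  move: N N3 => N' N3; positive_denominators R.
Qed.

Lemma closed_Iy a b x y : closed_I a b x y.+2 =
  (y%:R + 1) * (a%:R + b%:R + y%:R + N - 1)
  / ((a%:R + b%:R + x%:R + y%:R + N) * (b%:R + y%:R + N - 1)) * closed_I a b x y.
Proof.
have N3 : 3 <= N by rewrite (ler_nat _ 3).
rewrite /closed_I /closed_J !(addSn, addnS) dfact1S !dfact2S dfactS natrM -natr1 !natrD.
field; rewrite ?dfact1_neq0 ?dfact2_neq0 ?andbT /=;
  move: N N3 => N' N3; positive_denominators R.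
Qed.

End ClosedFormWeight.

(** * Identification of the Haar moments with the closed form *)

Section HaarMoments.
Variables (R : realType) (n : nat) (mu : probability (orthogonal_group R n) R).
Hypothesis hmu : is_haar mu.

(** Exchanging the two columns together with rows [r1] and [r2] permutes the factors of the
    monomial; this turns each relation into its mirror image. *)
Lemma momC r1 r2 r3 c1 c2 a b x y :
  mom mu r2 r1 r3 c2 c1 b a y x = mom mu r1 r2 r3 c1 c2 a b x y.
Proof. by apply: eq_expect => w; rewrite /mono; ring. Qed.

Lemma tmomC r1 r2 r3 c1 c2 a b x y :
  tmom mu r2 r1 r3 c2 c1 b a y x = tmom' mu r1 r2 r3 c1 c2 a b x y.
Proof. by apply: eq_expect => w; rewrite /mono; ring. Qed.

Lemma mom_closed r1 r2 r3 c1 c2 : (3 <= n)%N ->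
  r1 != r2 -> r1 != r3 -> r2 != r3 -> c1 != c2 -> forall a b x y,
  ~~ odd a -> ~~ odd b -> ~~ odd x -> ~~ odd y ->
  mom mu r1 r2 r3 c1 c2 a b x y = closed_I R n a b x y.
Proof.
move=> n3 r12 r13 r23 c12 a b x y ea eb ex ey.
have [r21 c21] : r2 != r1 /\ c2 != c1 by rewrite eq_sym r12 eq_sym c12.
have N3 : 3 <= n%:R :> R by rewrite (ler_nat _ 3).
have [] // := @moment_cross_closed R n%:R (mom mu r1 r2 r3 c1 c2)
  (sqmom mu r1 r2 r3 c1 c2 r2)
  (fun a b x y => sqmom mu r2 r1 r3 c2 c1 r1 b a y x)
  (tmom mu r1 r2 r3 c1 c2) (tmom' mu r1 r2 r3 c1 c2) (closed_I R n) N3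
  _ _ _ _ _ _ _ _ _ _ _ _ _ _ _ y ey a b x ea eb ex.
- rewrite -[RHS](expect_cst mu); apply: eq_expect => w.
  by rewrite /mono !expr0 !mulr1.
- by move=> *; exact: mom_row3.
- by move=> *; rewrite -[mom _ _ _ _ _ _ _ _ _ 2]momC -[RHS]momC mom_row3.
- by move=> *; exact: norm_rel.
- by move=> a' b' x' y'; rewrite -!(momC r1 r2 r3 c1 c2); exact: norm_rel.
- by move=> *; exact: orth_rel.
- move=> a' b' x' y'; rewrite -!(momC r1 r2 r3 c1 c2) -tmomC.
  by rewrite [a'%:R + _]addrC; exact: orth_rel.
- by move=> *; exact: rows23_rel.
- by move=> a' b' x' y'; rewrite -!(momC r1 r2 r3 c1 c2) -!tmomC; exact: rows23_rel.
- by move=> *; exact: columns_rel.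
- exact: closed_I0.
- exact: closed_Ia.
- exact: closed_Ib.
- exact: closed_Ix.
- exact: closed_Iy.
Qed.

End HaarMoments.

Theorem theorem6p3 (R : realType) (n : nat) (hn : (3 <= n)%N)
    (mu : probability (orthogonal_group R n) R) (hmu : is_haar mu) (a b : nat) :
  let J (c x y : nat) : R := J_moment mu hn hn (mx3 a b x y c) in
  (forall c x y : nat,
     let L := (a + b + c + x + y)%N in
     J c.+2 x y =
       ((L + n)%:R * J c x y - (x + 1)%:R * J c x.+2 y
        - (y + 1)%:R * J c x y.+2) / (c + n - 2)%:R) /\
  (~~ odd a -> ~~ odd b -> forall x y : nat, ~~ odd x -> ~~ odd y ->
     J 0%N x y =
       (dfact (n - 2) * dfact (a + b + x + n - 2) * dfact (a + b + y + n - 2))%N%:R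
       / (dfact (a + b + n - 2) * dfact (a + x + n - 2)
          * dfact (b + y + n - 2))%N%:R).
Proof.
move=> J.
pose r0 := widen_ord hn ord0; pose r1 := widen_ord hn (lift ord0 ord0).
pose r2 := widen_ord hn (lift ord0 (lift ord0 ord0)).
have IE c x y : I_moment mu hn hn (mx3 a b x y c)
    = expect mu (mono3 r0 r1 r2 r0 r1 r2 a b x y c).
  apply: eq_expect => w; rewrite !big_ord_recl !big_ord0 !mxE /= !expr0.
  by rewrite /mono3 /mono !(mul1r, mulr1) !mulrA.
have JcE c x y : J_coef R n (mx3 a b x y c)
    = dfact1 R n 0 * ((dfact a)%:R * (dfact b)%:R * (dfact x)%:R * (dfact y)%:R
      * (dfact c)%:R) / dfact1 R n (a + b + c + x + y).
  rewrite /J_coef !big_ord_recl !big_ord0 !mxE /=.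
  have d0 : dfact 0 = 1%N by rewrite /dfact unlock.
  rewrite d0 !(mul1n, muln1, addn0, add0n) !natrM !mulrA.
  congr (_ / (dfact _)%:R); lia.
split => [c x y L|ea eb x y ex ey].
  have cn0 : (c + n - 2)%:R != 0 :> R by rewrite pnatr_eq0 -lt0n; lia.
  have JE c' x' y' : J c' x' y' = expect mu (mono3 r0 r1 r2 r0 r1 r2 a b x' y' c')
      / (dfact1 R n 0 * ((dfact a)%:R * (dfact b)%:R * (dfact x')%:R * (dfact y')%:R
      * (dfact c')%:R) / dfact1 R n (a + b + c' + x' + y')).
    by rewrite /J /J_moment IE JcE.
  have L0 : (L + n)%:R != 0 :> R by rewrite pnatr_eq0 -lt0n; lia.
  have dn m : (dfact m)%:R != 0 :> R by rewrite pnatr_eq0 -lt0n dfact_gt0.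
  (* Only the moment of exponents [x, y, c] is expanded. The other three stay as atoms, and the
     ratios of double factorials produce the coefficients. *)
  rewrite !JE (@row3_norm_rel _ _ _ hmu r0 r1 r2 r0 r1 r2 _ _ _ _ _ a b x y c)//;
    last by lia.
  rewrite !addn1 !(addSn, addnS) -/L !dfact1S// !dfactS !natrM.
  rewrite natrD in L0 *.
  have d10 := @dfact1_neq0 R n.
  have nS m : m.+1%:R != 0 :> R by rewrite pnatr_eq0.
  by field; rewrite ?d10 ?dn ?cn0 ?L0 !nat1r !nS.
rewrite /J /J_moment IE JcE.
have -> : expect mu (mono3 r0 r1 r2 r0 r1 r2 a b x y 0) = mom mu r0 r1 r2 r0 r1 a b x y.
  by apply: eq_expect => w; rewrite /mono3 expr0 mulr1.
have d0 : dfact 0 = 1%N by rewrite /dfact unlock.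
(* [closed_I] is the normalizing factor times [closed_J], so the factor cancels once it is known to
   be nonzero. *)
rewrite (mom_closed hmu hn) // addn0 d0 mulr1 /closed_I mulrC mulKf.
  by rewrite /closed_J /dfact2 !natrM.
have d10 := @dfact1_neq0 R n.
by rewrite !mulf_neq0 ?invr_eq0 ?d10// pnatr_eq0 -lt0n dfact_gt0.
Qed.
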